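(* Let $m\in\mathbb{N}$, $m\ge1$, let $A\subseteq\mathbb{N}^m$ be a finite nonempty downward closed set, and let $P_A=\{p_\alpha\}_{\alpha\in A}\subseteq\Omega=[-1,1]^m$ be the node set generated by arbitrary distinct points $P_i\subseteq[-1,1]$, $i=1,\dots,m$. Let $P=\{p_1,\dots,p_K\}\subseteq\Omega$, $K\ge|A|$, be an arbitrary set of $K=|P|$ data points and let $f:\Omega\to\mathbb{R}$ be a continuous function. Assume that the regression matrix $R_{A,P}=(L_\alpha(p_i))_{i=1,\dots,K,\ \alpha\in A}\in\mathbb{R}^{K\times|A|}$ has full rank, $\mathrm{rank}\,R_{A,P}=|A|\le|P|$. Let $Q_{f,P,A}\in\Pi_A$ be the regressor of $f$ in $P$, with regression error $$\mu=\|\widetilde F-F\|_\infty,\qquad \widetilde F=(Q_{f,P,A}(p_i))_{i=1,\dots,K}\in\mathbb{R}^K,\quad F=(f(p_i))_{i=1,\dots,K}\in\mathbb{R}^K,$$ and let $Q_{f,A}=\sum_{\alpha\in A}f(p_\alpha)L_\alpha\in\Pi_A$ be the Lagrange interpolant of $f$ in $P_A$. Then $$\|f-Q_{f,P,A}\|_{C^0(\Omega)}\le\big(1+\Lambda(P_A)\,\|S_{A,P}\|_\infty\big)\,\|f-Q_{f,A}\|_{C^0(\Omega)}+\mu\,\Lambda(P_A)\,\|S_{A,P}\|_\infty,$$ where $S_{A,P}\in\mathbb{R}^{|A|\times|P|}$, with $S_{A,P}R_{A,P}=\mathrm{Id}_{\mathbb{R}^{|A|\times|A|}}$, is the Moore–Penrose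 pseudo-left-inverse of $R_{A,P}$.
   Context: Here $\mathbb{N}$ contains $0$ (as entries of multi-indices), $\Omega=[-1,1]^m$, and $\|g\|_{C^0(\Omega)}=\sup_{x\in\Omega}|g(x)|$. A set $A\subseteq\mathbb{N}^m$ is downward closed if $\alpha\in A$, $\beta\in\mathbb{N}^m$ and $\beta_i\le\alpha_i$ for all $i$ imply $\beta\in A$. $\Pi_A=\mathrm{span}\{x^\alpha:\alpha\in A\}$ is the space of real polynomials in $m$ variables spanned by the monomials with exponents in $A$. Nodes: $P_i=\{p_{0,i},\dots,p_{n_i,i}\}\subseteq[-1,1]$ consists of distinct points, $n_i=\max_{\alpha\in A}\alpha_i$, and $P_A=\{p_\alpha=(p_{\alpha_1,1},\dots,p_{\alpha_m,m}):\alpha\in A\}$. Such $P_A$ is unisolvent for $\Pi_A$ (the only element of $\Pi_A$ vanishing on $P_A$ is $0$). The notation $p_\alpha$ (multi-index) refers to interpolation nodes, and $p_i$ (integer index $i=1,\dots,K$) to data points in $P$. Lagrange polynomials: $L_\alpha\in\Pi_A$ is the unique polynomial with $L_\alpha(p_\beta)=\delta_{\alpha,\beta}$ for all $\beta\in A$; $\{L_\alpha\}_{\alpha\in A}$ is a basis of $\Pi_A$. The Lebesgue constant is $$\Lambda(P_A)=\sup_{f\in C^0(\Omega,\mathbb{R}),\ \|f\|_{C^0(\Omega)}\le1}\Big\|\sum_{\alpha\in A}f(p_\alpha)L_\alpha\Big\|_{C^0(\Omega)}=\Big\|\sum_{\alpha\in A}|L_\alpha|\Big\|_{C^0(\Omega)}.$$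 Regressor: when $R_{A,P}$ has full rank $|A|$, let $C=(c_\alpha)_{\alpha\in A}\in\mathbb{R}^{|A|}$ be the unique minimizer of $X\mapsto\|F-R_{A,P}X\|^2$ (Euclidean norm) over $X\in\mathbb{R}^{|A|}$, with $F=(f(p_i))_{i=1,\dots,K}$; then $Q_{f,P,A}=\sum_{\alpha\in A}c_\alpha L_\alpha$. The Moore–Penrose pseudo-left-inverse is $S_{A,P}=(R_{A,P}^{T}R_{A,P})^{-1}R_{A,P}^{T}$. For vectors $\|\cdot\|_\infty$ is the maximum norm, and for matrices it is the induced operator norm (maximum absolute row sum). *)

(* Defs.v *)
From mathcomp Require Import all_boot all_order all_algebra finmap.
From mathcomp Require Import all_classical all_reals all_analysis.
(* The notations of mpoly clash with those of the analysis library: multi-indices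
   are written [multinom m] and polynomials in m variables [mpoly m R]. *)
From mathcomp Require Export -(notations) mpoly.
Import numFieldNormedType.Exports.
Import Order.TTheory GRing.Theory Num.Theory.

Set Implicit Arguments.
Unset Strict Implicit.
Unset Printing Implicit Defensive.

Local Open Scope classical_set_scope.
Local Open Scope ring_scope.

Definition Omega (R : realType) (m : nat) : set 'rV[R]_m :=
  [set x | forall i, -1 <= x 0 i <= 1].

(* Real supremum: meaningful for g bounded on Omega, in particular for g
   continuous on Omega. *)
Definition C0norm (R : realType) (m : nat) (g : 'rV[R]_m -> R) : R :=
  sup [set `|g x| | x in @Omega R m].

Definition downward_closed (m : nat) (A : {fset multinom m}) : Prop :=
  forall a b : multinom m, a \in A -> (forall i, (b i <= a i)%N) -> b \in A.

Definition maxdeg (m : nat) (A : {fset multinom m}) (i : 'I_m) : nat :=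
  (\max_(a <- A) a i)%N.

(* [t i j] stands for the j-th point of P_i; only the values for
   [j <= maxdeg A i] matter. *)
Definition distinct_nodes (R : realType) (m : nat) (A : {fset multinom m})
    (t : 'I_m -> nat -> R) : Prop :=
  forall i, (forall j, (j <= maxdeg A i)%N -> -1 <= t i j <= 1) /\
    (forall j k, (j <= maxdeg A i)%N -> (k <= maxdeg A i)%N ->
       t i j = t i k -> j = k).

Definition node (R : realType) (m : nat) (t : 'I_m -> nat -> R)
    (a : multinom m) : 'rV[R]_m := \row_i t i (a i).

Definition mpeval (R : realType) (m : nat) (q : mpoly m R) (x : 'rV[R]_m) : R :=
  meval (fun i => x 0 i) q.

Definition PiA (R : realType) (m : nat) (A : {fset multinom m}) :
    set (mpoly m R) :=
  [set q | exists c : multinom m -> R, q = \sum_(a <- A) c a *: mpolyX R a].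

Definition lagrange (R : realType) (m : nat) (A : {fset multinom m})
    (t : 'I_m -> nat -> R) (a : multinom m) : mpoly m R :=
  xget 0 [set L | PiA A L /\
    forall b, b \in A -> mpeval L (node t b) = (b == a)%:R].

Definition interpolant (R : realType) (m : nat) (A : {fset multinom m})
    (t : 'I_m -> nat -> R) (f : 'rV[R]_m -> R) : mpoly m R :=
  \sum_(a <- A) f (node t a) *: lagrange A t a.

Definition lebesgue_const (R : realType) (m : nat) (A : {fset multinom m})
    (t : 'I_m -> nat -> R) : R :=
  sup [set C0norm (mpeval (interpolant A t f)) | f in
    [set f : 'rV[R]_m -> R |
      {within @Omega R m, continuous f} /\ C0norm f <= 1]].

(* Vectors and matrices indexed by A are indexed by the positions in the
   enumeration of A. *)
Definition idx (m : nat) (A : {fset multinom m}) (i : 'I_#|` A|) : multinom m :=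
  tnth (in_tuple A) i.

Definition regmx (R : realType) (m : nat) (A : {fset multinom m})
    (t : 'I_m -> nat -> R) (K : nat) (p : 'I_K -> 'rV[R]_m) :
    'M[R]_(K, #|` A|) :=
  \matrix_(i, j) mpeval (lagrange A t (idx j)) (p i).

Definition samples (R : realType) (m K : nat) (p : 'I_K -> 'rV[R]_m)
    (f : 'rV[R]_m -> R) : 'cV[R]_K := \col_i f (p i).

Definition norm2 (R : realType) (n : nat) (v : 'cV[R]_n) : R :=
  Num.sqrt (\sum_i v i 0 ^+ 2).

Definition least_squares (R : realType) (K n : nat) (M : 'M[R]_(K, n))
    (F : 'cV[R]_K) : 'cV[R]_n :=
  xget 0 [set X | forall Y, norm2 (F - M *m X) ^+ 2 <= norm2 (F - M *m Y) ^+ 2].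

Definition regressor (R : realType) (m : nat) (A : {fset multinom m})
    (t : 'I_m -> nat -> R) (K : nat) (p : 'I_K -> 'rV[R]_m)
    (f : 'rV[R]_m -> R) : mpoly m R :=
  let C := least_squares (regmx A t p) (samples p f) in
  \sum_(i < #|` A|) C i 0 *: lagrange A t (idx i).

(* Meaningful for M of full column rank. *)
Definition pseudo_left_inv (R : realType) (K n : nat) (M : 'M[R]_(K, n)) :
    'M[R]_(n, K) := invmx (M^T *m M) *m M^T.

(* On matrices, [`|_|] is the maximum of the absolute values of the entries, so
   on column vectors it is the maximum norm. *)
Definition opnorm (R : realType) (n K : nat) (M : 'M[R]_(n, K)) : R :=
  sup [set `|M *m X| | X in [set X : 'cV[R]_K | `|X| <= 1]].

Lemma colnorm_leP (R : realType) (n : nat) (v : 'cV[R]_n) (b : R) :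
  0 <= b -> (`|v| <= b) <-> (forall i, `|v i 0| <= b).
Proof.
move=> b0; have -> : `|v| = \big[Num.max/0]_ij `|v ij.1 ij.2| by exact: mx_normrE.
split => [/bigmax_leP[_ vb] i|vb]; first exact: (vb (i, 0)).
by apply/bigmax_leP; split => // -[i j] _ /=; rewrite ord1.
Qed.

Lemma opnormE (R : realType) (n K : nat) (M : 'M[R]_(n, K)) :
  opnorm M = \big[Num.max/0]_i \sum_j `|M i j|.
Proof.
set B := RHS.
have B0 : 0 <= B by exact: bigmax_ge_id.
have ub (X : 'cV[R]_K) : `|X| <= 1 -> `|M *m X| <= B.
  move=> /(iffLR (colnorm_leP _ ler01)) X1; apply/colnorm_leP => // i.
  rewrite mxE (le_trans (ler_norm_sum _ _ _)) //.
  apply: le_trans (le_bigmax _ (fun i => \sum_j `|M i j|) i).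
  by apply: ler_sum => k _; rewrite normrM ler_piMr.
have leS (X : 'cV[R]_K) : `|X| <= 1 -> `|M *m X| <= opnorm M.
  by move=> X1; apply: ub_le_sup; [exists B => _ [Y /ub MY <-] | exists X].
apply/eqP; rewrite eq_le; apply/andP; split.
  apply: ge_sup; last by move=> _ [X /ub MX <-].
  by exists `|M *m (0 : 'cV[R]_K)|, 0 => //=; rewrite normr0 ler01.
have S0 : 0 <= opnorm M.
  by apply: le_trans (leS 0 _); rewrite ?normr_ge0 ?normr0 ?ler01.
apply/bigmax_leP; split => // i _.
pose X : 'cV[R]_K := \col_j Num.sg (M i j).
have X1 : `|X| <= 1.
  apply: (iffRL (colnorm_leP _ ler01)) => j; rewrite mxE normr_sg.
  by case: (_ != 0); rewrite ?ler01.
apply: le_trans (iffLR (colnorm_leP _ S0) (leS X X1) i).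
rewrite mxE; under [X in _ <= `|X|]eq_bigr do rewrite mxE mulrC -normrEsg.
exact: ler_norm.
Qed.

(* Main.v *)
Require Import Defs.
From mathcomp Require Import all_boot all_order all_algebra finmap.
From mathcomp Require Import all_classical all_reals all_analysis.
From mathcomp Require Import ring.
Import numFieldNormedType.Exports.
Local Open Scope classical_set_scope.
Local Open Scope ring_scope.
Import Order.TTheory GRing.Theory Num.Theory.

(** Write C for the coefficients of the regressor Q and D = (f(p_a))_a for those
    of the interpolant QA, F for the samples of f at the data points and R for
    the regression matrix. The latter evaluates a coefficient vector at these
    points, so R C and R D are the samples of Q and of QA there, and applying the left
    inverse S gives
      D - C = S (R D - R C) = S ((F - R C) - (F - R D)).
    The first bracket has maximum norm mu, the second at most
    N = ||f - QA||, since the data points lie in Omega; hence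
    |D - C| <= ||S|| (mu + N). The function QA - Q is the combination of the
    Lagrange polynomials with coefficients D - C, so its norm is at most
    Lambda |D - C| ([lebesgue_const_bound]), and the triangle inequality
    |f - Q| <= |f - QA| + |QA - Q| gives the estimate.

    The analytic work is in [lebesgue_const_bound]. As Lambda is a supremum over
    continuous functions, bounding a combination with arbitrary coefficients
    requires realizing these coefficients as the node values of a continuous
    function of the same bound ([bounded_continuous_prescribed_values]). It
    also requires the supremum to range over a bounded set, which is where the
    continuity of polynomials and the compactness of Omega come in.

    That S is a left inverse follows from the full rank of R: over the reals
    the Gram matrix R^T R has the same kernel as R ([gram_unitmx]). *)

Set Implicit Arguments.
Unset Strict Implicit.
Unset Printing Implicit Defensive.

(** * The norm on the cube *)

Lemma compact_Omega (R : realType) (m : nat) : compact (@Omega R m).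
Proof.
have -> : @Omega R m =
    [set v | forall i, [set` `[-1, 1]%R] (v ord0 i)].
  by apply/seteqP; split=> x /= Ox i; move: (Ox i); rewrite in_itv.
exact: (@rV_compact R m (fun=> [set` `[-1, 1]%R])
  (fun=> @segment_compact R (-1) 1)).
Qed.

Lemma Omega0 (R : realType) (m : nat) : @Omega R m 0.
Proof. by move=> i; rewrite mxE lerN10 ler01. Qed.

(** A supremum in the reals bounds its set only if that set is bounded; for a
    continuous function this is compactness of the cube. *)
Lemma C0norm_ge (R : realType) (m : nat) (g : 'rV[R]_m -> R) x :
  {within @Omega R m, continuous g} -> @Omega R m x -> `|g x| <= C0norm g.
Proof.
move=> cg Ox; apply: ub_le_sup; last by exists x.
have /compact_bounded[M [_ gM]] := continuous_compact cg (@compact_Omega R m).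
by exists (M + 1) => _ [y Oy <-]; apply: gM; [rewrite ltrDl | exists y].
Qed.

Lemma C0norm_le (R : realType) (m : nat) (g : 'rV[R]_m -> R) b :
  (forall x, @Omega R m x -> `|g x| <= b) -> C0norm g <= b.
Proof.
move=> gb; apply: ge_sup; last by move=> _ [x /gb ? <-].
by exists `|g 0|, 0 => //; exact: Omega0.
Qed.

(** * Polynomials as continuous functions *)

Lemma mpeval_sum (R : realType) (m : nat) (I : Type) (s : seq I) (d : I -> R)
    (L : I -> mpoly m R) x :
  mpeval (\sum_(i <- s) d i *: L i) x = \sum_(i <- s) d i * mpeval (L i) x.
Proof.
by rewrite /mpeval raddf_sum; apply: eq_bigr => i _ /=; rewrite mevalZ.
Qed.

Lemma continuous_mpeval (R : realType) (m : nat) (q : mpoly m R) :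
  continuous (mpeval q).
Proof.
rewrite (_ : mpeval q = fun x => \sum_(a <- msupp q)
    mcoeff a q * \prod_i x 0 i ^+ a i); last by apply/funext => x; exact: mevalE.
apply: (continuous_big (@add_continuous R^o)) => a _ x.
apply: continuousM; first exact: cst_continuous.
apply: (continuous_big (@mul_continuous R)) => i _ {}x.
exact: (continuous_comp (@coord_continuous _ _ _ _ _ _) (@exprn_continuous _ _ _)).
Qed.

(** * Continuous functions with prescribed values *)

(** Newton's scheme: to reach one more point y, correct the function found so
    far by a multiple of a function that vanishes at the earlier points and not
    at y. The product of the distances to the earlier points is such a
    function. *)
Lemma continuous_prescribed_values (R : realType) (V : normedModType R)
    (s : seq V) (d : V -> R) :
  exists2 g : V -> R, continuous g & forall y, y \in s -> g y = d y.
Proof.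
elim: s => [|y s [g cg gd]]; first by exists (fun=> 0) => // ?; exact: cst_continuous.
have [ys|ys] := boolP (y \in s).
  by exists g => // z; rewrite inE => /predU1P[->|]; exact: gd.
pose w x := \prod_(z <- s) `|x - z|.
have cw : continuous w.
  apply: (continuous_big (@mul_continuous R)) => z _ x.
  apply: (@continuous_comp _ _ _ (fun x : V => x - z) Num.norm).
    by apply: continuousB => //; exact: cst_continuous.
  exact: norm_continuous.
have wy : w y != 0.
  rewrite prodf_seq_neq0; apply/allP => z zs /=; rewrite normr_eq0 subr_eq0.
  by apply: contraNneq ys => ->.
exists (fun x => g x + (d y - g y) / w y * w x) => [x|z].
  apply: (@continuousD R R^o V); first exact: cg.
  by apply: continuousM; [exact: cst_continuous | exact: cw].
rewrite inE => /predU1P[->|zs]; first by rewrite divfK // subrKC.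
by rewrite gd // [w z](big_rem z) //= subrr normr0 mul0r mulr0 addr0.
Qed.

(** Truncating at -b and b preserves continuity and the prescribed values, as
    these already lie in that range. *)
Lemma bounded_continuous_prescribed_values (R : realType) (V : normedModType R)
    (s : seq V) (d : V -> R) (b : R) :
  0 <= b -> (forall y, y \in s -> `|d y| <= b) ->
  exists g : V -> R, [/\ continuous g, forall y, y \in s -> g y = d y &
    forall x, `|g x| <= b].
Proof.
move=> b0 db; have [g cg gd] := continuous_prescribed_values s d.
exists ((cst (- b) : V -> R) \max ((cst b : V -> R) \min g)); split.
- move=> x; apply: continuous_max; first exact: cst_continuous.
  by apply: continuous_min; [exact: cst_continuous | exact: cg].
- move=> y ys /=; rewrite gd //; move: (db y ys); rewrite ler_norml => /andP[? ?].
  by rewrite min_r // max_r.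
- move=> x /=; rewrite ler_norml le_max lexx /= ge_max ge_min lexx /= andbT.
  by rewrite ge0_cp.
Qed.

(** * The Lebesgue constant *)

Lemma leq_maxdeg (m : nat) (A : {fset multinom m}) a i :
  a \in A -> (a i <= maxdeg A i)%N.
Proof.
by move=> aA; apply: (leq_bigmax_seq (F := fun a : multinom m => a i)).
Qed.

Lemma node_Omega (R : realType) (m : nat) (A : {fset multinom m}) t a :
  @distinct_nodes R m A t -> a \in A -> @Omega R m (node t a).
Proof.
move=> tA aA i; rewrite mxE; apply: (tA i).1; exact: leq_maxdeg.
Qed.

Lemma node_inj (R : realType) (m : nat) (A : {fset multinom m}) t :
  @distinct_nodes R m A t -> {in A &, injective (node t)}.
Proof.
move=> tA a b aA bA /rowP tab; apply/mnmP => i.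
have := tab i; rewrite !mxE; apply: (tA i).2; exact: leq_maxdeg.
Qed.

(** The set whose supremum is the Lebesgue constant is bounded by the sum of the
    norms of the Lagrange polynomials, because |f| <= 1 at the nodes. *)
Lemma C0norm_interpolant (R : realType) (m : nat) (A : {fset multinom m}) t f :
  @distinct_nodes R m A t -> {within @Omega R m, continuous f} ->
  C0norm f <= 1 -> C0norm (mpeval (interpolant A t f)) <= lebesgue_const A t.
Proof.
move=> tA cf f1; apply: ub_le_sup; last by exists f.
exists (\sum_(a <- A) C0norm (mpeval (Defs.lagrange A t a))).
move=> _ [g [cg g1] <-]; apply: C0norm_le => x Ox.
rewrite mpeval_sum (le_trans (ler_norm_sum _ _ _)) // !big_seq.
apply: ler_sum => a aA; rewrite normrM -[leRHS]mul1r ler_pM //.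
  exact: le_trans (C0norm_ge cg (node_Omega tA aA)) g1.
by apply: C0norm_ge => //; apply: continuous_subspaceT; exact: continuous_mpeval.
Qed.

Lemma mem_idx (m : nat) (A : {fset multinom m}) i : @idx m A i \in A.
Proof. exact: mem_tnth. Qed.

Lemma idx_inj (m : nat) (A : {fset multinom m}) : injective (@idx m A).
Proof. by apply/tuple_uniqP; exact: fset_uniq. Qed.

Lemma mpeval_interpolant (R : realType) (m : nat) (A : {fset multinom m}) t f x :
  mpeval (@interpolant R m A t f) x =
  \sum_(i < #|` A|) f (node t (idx i)) * mpeval (Defs.lagrange A t (idx i)) x.
Proof. by rewrite mpeval_sum; exact: (big_tnth _ _ (in_tuple A)). Qed.

(** After scaling, the coefficients are at most 1 in absolute value, hence are
    the values at the nodes of a continuous function g with |g| <= 1; the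
    combination is then a multiple of the interpolant of g. *)
Lemma lebesgue_const_bound (R : realType) (m : nat) (A : {fset multinom m}) t
    (d : 'cV[R]_#|` A|) x :
  @distinct_nodes R m A t -> @Omega R m x ->
  `|\sum_i d i 0 * mpeval (Defs.lagrange A t (idx i)) x| <= lebesgue_const A t * `|d|.
Proof.
move=> tA Ox; set b := `|d|.
have db : forall i, `|d i 0| <= b.
  exact: (iffLR (@colnorm_leP _ _ d _ (normr_ge0 _)) (lexx _)).
have [b_eq0|bN0] := eqVneq b 0.
  rewrite b_eq0 mulr0 big1 ?normr0 // => i _.
  by move: (db i); rewrite b_eq0 normr_le0 => /eqP ->; rewrite mul0r.
have bp : 0 < b by rewrite lt_neqAle eq_sym bN0 normr_ge0.
(* The sum turns a family indexed by the nodes' positions into a function of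
   the point: the nodes being distinct, it has one term at each of them. *)
pose e y := \sum_(i | node t (idx i) == y) d i 0 / b.
have eE i : e (node t (idx i)) = d i 0 / b.
  rewrite /e (big_pred1 i) // => j /=; apply/eqP/eqP => [|-> //].
  by move=> /(node_inj tA (mem_idx j) (mem_idx i)); exact: idx_inj.
have [y /mapP[i _ ->]|g [cg ge g1]] :=
    @bounded_continuous_prescribed_values R 'rV[R]_m
      [seq node t (idx i) | i <- enum 'I_#|` A|] e 1 ler01.
  by rewrite eE normrM normfV (gtr0_norm bp) ler_pdivrMr // mul1r db.
rewrite -ler_pdivrMr //.
have wg : {within @Omega R m, continuous g} by exact: continuous_subspaceT.
have /(C0norm_interpolant tA wg) : C0norm g <= 1 by exact: C0norm_le.
apply: le_trans; apply: le_trans (C0norm_ge (x := x) _ Ox); last first.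
  by apply: continuous_subspaceT; exact: continuous_mpeval.
rewrite -{1}(gtr0_norm bp) -normfV -normrM mpeval_interpolant mulr_suml.
rewrite le_eqVlt; apply/orP; left; apply/eqP; congr `|_|.
apply: eq_bigr => i _; rewrite ge ?eE 1?mulrAC //.
by apply/mapP; exists i; rewrite ?mem_enum.
Qed.

(** * The pseudo-left-inverse *)

(** If v M^T M = 0 then v M^T M v^T, the sum of the squares of the entries of
    v M^T, vanishes; so v M^T = 0, and v = 0 as M^T has independent rows. *)
Lemma gram_unitmx (R : realType) (K n : nat) (M : 'M[R]_(K, n)) :
  \rank M = n -> M^T *m M \in unitmx.
Proof.
move=> rM; rewrite -row_free_unit; apply/inj_row_free => v vMM.
have frM : row_free M^T by rewrite /row_free mxrank_tr rM.
apply: (row_free_inj frM); rewrite mul0mx.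
have sq0 : \sum_k (v *m M^T) 0 k ^+ 2 = 0.
  transitivity ((v *m M^T *m (v *m M^T)^T) 0 0).
    by rewrite [RHS]mxE; apply: eq_bigr => k _; rewrite [_^T k 0]mxE expr2.
  by rewrite trmx_mul trmxK mulmxA -(mulmxA v) vMM mul0mx mxE.
apply/rowP => k; rewrite [RHS]mxE; apply/eqP; rewrite -sqrf_eq0.
by apply/eqP; apply: (psumr_eq0P _ sq0) => // i _; exact: sqr_ge0.
Qed.

Lemma pseudo_left_invK (R : realType) (K n : nat) (M : 'M[R]_(K, n)) :
  \rank M = n -> pseudo_left_inv M *m M = 1%:M.
Proof. by move=> rM; rewrite -mulmxA mulVmx ?gram_unitmx. Qed.

(** The supremum defining the operator norm is the maximum absolute row sum,
    which bounds every entry of M X. *)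
Lemma ler_opnorm (R : realType) (n K : nat) (M : 'M[R]_(n, K)) (X : 'cV[R]_K) :
  `|M *m X| <= opnorm M * `|X|.
Proof.
have M0 : 0 <= opnorm M by rewrite opnormE; exact: bigmax_ge_id.
apply/colnorm_leP => [|i]; first by rewrite mulr_ge0.
rewrite mxE (le_trans (ler_norm_sum _ _ _)) //.
have Xle := iffLR (@colnorm_leP _ _ X _ (normr_ge0 _)) (lexx _).
rewrite opnormE; apply: le_trans (ler_wpM2r (normr_ge0 X)
  (le_bigmax 0 (fun i => \sum_j `|M i j|) i)).
rewrite mulr_suml; apply: ler_sum => j _.
by rewrite normrM ler_wpM2l.
Qed.

(** * The regression estimate *)

Theorem theorem3p4 (R : realType) (m : nat) (A : {fset multinom m})
    (t : 'I_m -> nat -> R) (K : nat) (p : 'I_K -> 'rV[R]_m)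
    (f : 'rV[R]_m -> R) :
  (0 < m)%N -> A != fset0 -> downward_closed A -> distinct_nodes A t ->
  (forall k, @Omega R m (p k)) -> injective p -> (#|` A| <= K)%N ->
  {within @Omega R m, continuous f} ->
  \rank (regmx A t p) = #|` A| ->
  let Q := regressor A t p f in
  let mu := `|samples p (mpeval Q) - samples p f| in
  let S := pseudo_left_inv (regmx A t p) in
  S *m regmx A t p = 1%:M /\
  C0norm (fun x => f x - mpeval Q x) <=
    (1 + lebesgue_const A t * opnorm S)
      * C0norm (fun x => f x - mpeval (interpolant A t f) x)
    + mu * lebesgue_const A t * opnorm S.
Proof.
move=> _ _ _ tA pO _ _ cf rM Q mu S.
have SM : S *m regmx A t p = 1%:M by exact: pseudo_left_invK.
split=> //.
set N := C0norm (fun x => f x - mpeval (interpolant A t f) x).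
set La := lebesgue_const A t.
set C := least_squares (regmx A t p) (samples p f).
pose D : 'cV[R]_#|` A| := \col_i f (node t (idx i)).
have QE x : mpeval Q x = \sum_i C i 0 * mpeval (Defs.lagrange A t (idx i)) x.
  exact: mpeval_sum.
have QAE x : mpeval (interpolant A t f) x =
    \sum_i D i 0 * mpeval (Defs.lagrange A t (idx i)) x.
  by rewrite mpeval_interpolant; apply: eq_bigr => i _; rewrite mxE.
have errN x : @Omega R m x -> `|f x - mpeval (interpolant A t f) x| <= N.
  move=> Ox; apply: (@C0norm_ge _ _ (f \- mpeval (interpolant A t f)) x) => //.
  apply: within_continuousB => //; apply: continuous_subspaceT.
  exact: continuous_mpeval.
have N0 : 0 <= N := le_trans (normr_ge0 _) (errN _ (@Omega0 R m)).
have S0 : 0 <= opnorm S by rewrite opnormE; exact: bigmax_ge_id.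
have La0 : 0 <= La.
  apply: le_trans (C0norm_interpolant (f := fun=> 0) tA _ _).
  - apply: le_trans (C0norm_ge (x := 0) _ (@Omega0 R m)); first exact: normr_ge0.
    by apply: continuous_subspaceT; exact: continuous_mpeval.
  - by apply: continuous_subspaceT; exact: cst_continuous.
  - by apply: C0norm_le => x _; rewrite normr0 ler01.
have DC : D - C = S *m (samples p f - samples p (mpeval Q)
    - (samples p f - samples p (mpeval (interpolant A t f)))).
  rewrite opprB [X in S *m X]addrC subrKA.
  rewrite -[LHS]mul1mx -SM -mulmxA mulmxBr; congr (S *m (_ - _)).
    apply/colP => k; rewrite !mxE QAE; apply: eq_bigr => i _.
    by rewrite mxE mulrC.
  by apply/colP => k; rewrite !mxE QE; apply: eq_bigr => i _; rewrite mxE mulrC.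
have DCle : `|D - C| <= opnorm S * (mu + N).
  rewrite DC; apply: le_trans (ler_opnorm _ _) _; rewrite ler_wpM2l //.
  apply: le_trans (ler_normB _ _) _; rewrite lerD //; first by rewrite distrC.
  by apply/colnorm_leP => // k; rewrite !mxE errN.
apply: C0norm_le => x Ox.
have -> : f x - mpeval Q x = f x - mpeval (interpolant A t f) x +
    \sum_i (D - C) i 0 * mpeval (Defs.lagrange A t (idx i)) x.
  rewrite -(subrKA (mpeval (interpolant A t f) x)); congr (_ + _).
  rewrite QE QAE -sumrB; apply: eq_bigr => i _.
  by rewrite [(D - C) i 0]mxE [(- C) i 0]mxE mulrBl.
apply: le_trans (ler_normD _ _) _.
have -> : (1 + La * opnorm S) * N + mu * La * opnorm S =
    N + La * (opnorm S * (mu + N)) by ring.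
rewrite lerD ?errN //; apply: le_trans (lebesgue_const_bound _ tA Ox) _.
by rewrite ler_wpM2l.
Qed.
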